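(* Let $M\in\mathbb{R}_{>0}^{\mathbb{N}}$ and $\Phi\in\mathbb{R}_{\ge 0}^{\mathbb{N}}$, and let $\mathcal{M}_{M,\Phi}:=\{M^{(c,\Phi)}:c>0\}$ with $M^{(c,\Phi)}_j:=c^{\Phi_j}M_j$. Let $U\subseteq\mathbb{R}^d$ be non-empty and open. (i) (Roumieu case) Assume that $M^{(c,\Phi)}$ is log-convex and normalized for some $c>0$ and that $\mathcal{E}_{\{\mathcal{M}_{M,\Phi}\}}(U)\subseteq\mathcal{E}_{\{M,\Phi\}}(U)$ as sets. Then $\liminf_{j\to\infty}\Phi_j/j>0$. In particular this implication holds for any $M\in\mathcal{LC}$. (ii) (Beurling case) Assume that for every $c>0$ one has $\lim_{j\to\infty}(M^{(c,\Phi)}_j)^{1/j}=+\infty$ and that, after possibly changing finitely many of its terms, $M^{(c,\Phi)}$ is log-convex with value $1$ at $j=0$. Assume also that $\mathcal{E}_{(M,\Phi)}(U)\subseteq\mathcal{E}_{(\mathcal{M}_{M,\Phi})}(U)$ as sets (and thus automatically with continuous inclusion of Fréchet spaces). Then $\liminf_{j\to\infty}\Phi_j/j>0$.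
   Context: $\mathbb{N}=\{0,1,2,\dots\}$. A sequence $N\in\mathbb{R}_{>0}^{\mathbb{N}}$ is normalized if $1=N_0\le N_1$, and log-convex if $N_j^2\le N_{j-1}N_{j+1}$ for all $j\ge 1$. $\mathcal{LC}$ is the set of normalized log-convex $N$ with $\lim_{j\to\infty}(N_j)^{1/j}=\infty$. $\mathcal{E}(U)$ denotes the smooth complex-valued functions on $U$. For compact $K\subset U$ and $h>0$ put $\|f\|_{M,\Phi,K,h}:=\sup_{\alpha\in\mathbb{N}^d,x\in K}\frac{|f^{(\alpha)}(x)|}{h^{\Phi_{|\alpha|}}M_{|\alpha|}}$ and $\|f\|_{M,K,h}:=\sup_{\alpha\in\mathbb{N}^d,x\in K}\frac{|f^{(\alpha)}(x)|}{h^{|\alpha|}M_{|\alpha|}}$. Then - $\mathcal{E}_{\{M,\Phi\}}(U)$ (resp. $\mathcal{E}_{(M,\Phi)}(U)$): all $f\in\mathcal{E}(U)$ such that for every compact $K\subset U$ and some (resp. every) $h>0$, $\|f\|_{M,\Phi,K,h}<\infty$; - for a family $\mathcal{M}=\{M^{(x)}:x>0\}$ of positive sequences pointwise non-decreasing in $x$, $\mathcal{E}_{\{\mathcal{M}\}}(U)$ (resp. $\mathcal{E}_{(\mathcal{M})}(U)$): all $f\in\mathcal{E}(U)$ such that for every compact $K\subset U$ there exist $x,h>0$ with (resp. for all $x,h>0$ one has) $\|f\|_{M^{(x)},K,h}<\infty$. The Beurling classes carry the Fréchet topology given by all the respective seminorms. *)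

(* Defs.v *)
From mathcomp Require Import all_boot all_order all_algebra.
From mathcomp Require Import all_classical all_reals all_analysis.
From mathcomp Require Import complex.

Set Implicit Arguments.
Unset Strict Implicit.
Unset Printing Implicit Defensive.

Import Order.TTheory GRing.Theory Num.Theory.
Import numFieldNormedType.Exports.

Local Open Scope classical_set_scope.
Local Open Scope ring_scope.

Section WeightSequences.
Context {R : realType}.
Implicit Types (N M Phi : nat -> R).

Definition positive_seq N := forall j, 0 < N j.

Definition normalized N := N 0%N = 1 /\ 1 <= N 1%N.

Definition log_convex N :=
  forall j, (1 <= j)%N -> N j ^+ 2 <= N j.-1 * N j.+1.

(* The term at j = 0, where j%:R^-1 = 0, is irrelevant to the limit. *)
Definition root_tends_to_infty N := (N j `^ j%:R^-1) @[j --> \oo] --> +oo.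

Definition class_LC N :=
  [/\ positive_seq N, normalized N, log_convex N & root_tends_to_infty N].

Definition log_convex_up_to_finite N :=
  exists N', [/\ finite_set [set j | N' j <> N j], positive_seq N',
                 log_convex N' & N' 0%N = 1].

Definition Mc M Phi (c : R) : nat -> R := fun j => c `^ Phi j * M j.

(* The term at j = 0 is the junk value 0, irrelevant to the lower limit. *)
Definition liminf_ratio Phi : \bar R :=
  limn_einf (fun j => (Phi j / j%:R)%:E).

End WeightSequences.

Section SmoothFunctions.
Context {R : realType} {d : nat}.

(* A function on an open U is represented by a function on the whole space;
   everything below only depends on its values on U as long as U is open. *)
Local Notation cfun := ('rV[R]_d -> R[i]).
Implicit Types (f g : cfun) (U K : set 'rV[R]_d).

(* R[i] is not a normed module over R in the library, hence the derivative of
   a complex-valued function of real variables is taken componentwise. *)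
Definition partial_derivative (i : 'I_d) f : cfun := fun x =>
  Complex ('D_(delta_mx 0 i) (fun y => complex.Re (f y)) x)
          ('D_(delta_mx 0 i) (fun y => complex.Im (f y)) x).

Definition iterated_partial (s : seq 'I_d) f : cfun :=
  foldr partial_derivative f s.

(* Partial derivatives of all orders, in any order of differentiation, exist
   and are continuous at every point of U. *)
Definition smooth_on U f :=
  forall (s : seq 'I_d) (x : 'rV[R]_d), U x ->
    let g := iterated_partial s f in
    [/\ {for x, continuous (fun y => complex.Re (g y))},
        {for x, continuous (fun y => complex.Im (g y))} &
        forall i : 'I_d,
          derivable (fun y => complex.Re (g y)) x (delta_mx 0 i) /\
          derivable (fun y => complex.Im (g y)) x (delta_mx 0 i)].

Definition multi_index := {ffun 'I_d -> nat}.

Definition order_mi (a : multi_index) : nat := (\sum_(i < d) a i)%N.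

Definition derivative_mi (a : multi_index) f : cfun :=
  foldr (fun i g => iter (a i) (partial_derivative i) g) f (enum 'I_d).

(* With values in \bar R. The supremum over the empty set is -oo rather than
   0, which has no effect on the comparisons with positive bounds below. *)
Definition weighted_norm (W : nat -> R) K f : \bar R :=
  ereal_sup [set y | exists (a : multi_index) (x : 'rV[R]_d), K x /\
    y = (ComplexField.Normc.normc (derivative_mi a f x) / W (order_mi a))%:E].

Definition norm_MPhi (M Phi : nat -> R) K (h : R) f : \bar R :=
  weighted_norm (fun j => h `^ Phi j * M j) K f.

Definition norm_M (M : nat -> R) K (h : R) f : \bar R :=
  weighted_norm (fun j => h ^+ j * M j) K f.

Definition compact_in U K := compact K /\ K `<=` U.

Definition roumieu_MPhi (M Phi : nat -> R) U : set cfun :=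
  [set f | smooth_on U f /\ forall K, compact_in U K ->
    exists h : R, 0 < h /\ (norm_MPhi M Phi K h f < +oo)%E].

Definition beurling_MPhi (M Phi : nat -> R) U : set cfun :=
  [set f | smooth_on U f /\ forall K, compact_in U K ->
    forall h : R, 0 < h -> (norm_MPhi M Phi K h f < +oo)%E].

(* Only the members of the family with positive parameter matter. *)
Definition roumieu_family (F : R -> nat -> R) U : set cfun :=
  [set f | smooth_on U f /\ forall K, compact_in U K ->
    exists x h : R, [/\ 0 < x, 0 < h & (norm_M (F x) K h f < +oo)%E]].

Definition beurling_family (F : R -> nat -> R) U : set cfun :=
  [set f | smooth_on U f /\ forall K, compact_in U K ->
    forall x h : R, 0 < x -> 0 < h -> (norm_M (F x) K h f < +oo)%E].

Definition beurling_MPhi_seminorms (M Phi : nat -> R) U :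
    set (cfun -> \bar R) :=
  [set p | exists K (h : R),
    [/\ compact_in U K, 0 < h & p = norm_MPhi M Phi K h]].

Definition beurling_family_seminorms (F : R -> nat -> R) U :
    set (cfun -> \bar R) :=
  [set q | exists K (x h : R),
    [/\ compact_in U K, 0 < x, 0 < h & q = norm_M (F x) K h]].

(* A is included in B, and the inclusion is continuous from A with the
   topology generated by the seminorms P to B with the topology generated by
   the seminorms Q, in terms of the basic neighbourhoods of these topologies
   (finite intersections of balls for the generating seminorms). *)
Definition continuous_inclusion (A B : set cfun)
    (P Q : set (cfun -> \bar R)) :=
  A `<=` B /\
  forall f, A f -> forall q, Q q -> forall e : R, 0 < e ->
    exists (P' : set (cfun -> \bar R)) (r : R),
      [/\ finite_set P', P' `<=` P, 0 < r &
          forall g, A g -> (forall p, P' p -> (p (g \- f)%R < r%:E)%E) ->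
            (q (g \- f)%R < e%:E)%E].

End SmoothFunctions.

(* Main.v *)
(** Test functions are sums [f x = \sum_k b k * exp (i * lam k * (x i0 - a i0))]
    with [b k, lam k >= 0]. Differentiating [m] times in the direction [i0]
    gives everywhere at most [\sum_k b k * lam k ^+ m], with equality at [a],
    where all the terms have the same argument.

    Roumieu case: for a log-convex [N] with slopes [nu k = N k.+1 / N k], the
    choice [lam k = 4 * nu k], [b k = 2 ^- k * N k / nu k ^+ k] gives a function
    with derivatives bounded by [4 ^ m * N m], and at least [2 ^ m * N m] at [a].
    Applied to [N = c ^ Phi * M], the inclusion yields
    [2 ^ m <= D * (h / c) ^ Phi m] for some [h], so that [Phi] grows linearly.

    Beurling case: if [Phi] is not eventually bounded below by a linear function,
    then each weight [(k + 1) ^- Phi * M] provides one pair [(b k, lam k)] which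
    is small for that weight but satisfies [b k * lam k ^ j >= k * 2 ^- j * M j]
    for some [j]. Since no cancellation occurs at [a], the resulting [f] is in
    the Beurling class of [(M, Phi)] but not in that of the family, and no
    closed graph theorem is needed. Continuity of the inclusion is a consequence:
    linear growth of [Phi] bounds each seminorm of the target by a multiple of
    one seminorm of the source. *)
Require Import Defs.
From mathcomp Require Import all_boot all_order all_algebra.
From mathcomp Require Import all_classical all_reals all_analysis.
From mathcomp Require Import complex ring lra.

Set Implicit Arguments.
Unset Strict Implicit.
Unset Printing Implicit Defensive.

Import Order.TTheory GRing.Theory Num.Theory.
Import numFieldNormedType.Exports.

Local Open Scope classical_set_scope.
Local Open Scope ring_scope.

(** * Cosine series with rapidly decreasing coefficients, differentiated term by term *)

Section TrigonometricSeries.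
Context {R : realType}.

Lemma is_cvg_geometric_bounded (u : nat -> R) (A : R) :
  (forall k, `|u k| <= A / 2 ^+ k) -> cvgn [normed series u].
Proof.
have gE k : geometric A 2^-1 k = A / 2 ^+ k by rewrite /= exprVn.
move=> uA; apply: (@series_le_cvg _ _ (geometric A 2^-1)) => [k|k|k|].
- exact: normr_ge0.
- by rewrite gE; exact: le_trans (normr_ge0 _) (uA k).
- by rewrite gE; exact: uA.
- by apply: is_cvg_geometric_series; rewrite ger0_norm; lra.
Qed.

Lemma norm_lim_geometric_bounded (u : nat -> R) (A : R) :
  (forall k, `|u k| <= A / 2 ^+ k) -> `|limn (series u)| <= 2 * A.
Proof.
move=> uA; have cu := is_cvg_geometric_bounded uA.
apply: (le_trans (lim_series_norm cu)).
have z2 : `|2^-1 : R| < 1 by rewrite ger0_norm; lra.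
rewrite (_ : 2 * A = limn (series (geometric A 2^-1))).
  by apply: lim_series_le => // [|k]; [exact: is_cvg_geometric_series|rewrite /= exprVn].
rewrite (cvg_lim _ (@cvg_geometric_series _ A _ z2))//.
by rewrite (_ : 1 - 2^-1 = 2^-1); [rewrite invrK mulrC|lra].
Qed.

(** A quadratic bound on the Taylor remainder is a condition that can be summed over the terms of a
    series, so term-by-term differentiation reduces to one numerical estimate. *)
Lemma is_derive_quadratic (f : R -> R) (t l C : R) :
  (forall s, `|f (s + t) - f t - s * l| <= C * s ^+ 2) ->
  is_derive t 1 f l.
Proof.
move=> fq.
have C0 : 0 <= C.
  by have := le_trans (normr_ge0 _) (fq 1); rewrite expr1n mulr1.
suff h : h^-1 *: ((f \o shift t) (h *: (1 : R)) - f t) @[h --> 0^'] --> l.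
  by apply: DeriveDef; [apply/cvg_ex; exists l|exact/cvg_lim].
apply/cvgrPdist_le => /= e e0.
near=> s.
have s0 : s != 0 by near: s; exact: nbhs_dnbhs_neq.
rewrite distrC /= (_ : _ *: _ - l = s^-1 * (f (s + t) - f t - s * l)); last first.
  by rewrite [s *: 1]mulr1 [RHS]mulrBr mulKf.
rewrite normrM normfV mulrC ler_pdivrMr ?normr_gt0//.
apply: (le_trans (fq s)); rewrite -real_normK ?num_real// expr2 mulrA.
apply: ler_wpM2r => //.
(* [C + 1] replaces [C], which may be zero, so that the radius [e / (C + 1)] makes sense. *)
apply: (@le_trans _ _ ((C + 1) * `|s|)); first by rewrite ler_wpM2r// lerDl.
rewrite mulrC -ler_pdivlMr ?ltr_wpDl//; near: s.
apply: (@dnbhs0_le _ R); rewrite divr_gt0// ltr_wpDl//.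
Unshelve. all: by end_near. Qed.

Lemma norm_sinB_le (x y : R) : `|sin x - sin y| <= `|x - y|.
Proof.
wlog xy : x y / x <= y.
  move=> h; case/orP: (le_total x y) => [/h//|/h].
  by rewrite distrC [X in _ <= X]distrC.
have [|c _ e] := @MVT_segment R sin cos x y xy (fun z _ => is_derive_sin z).
  by apply/continuous_subspaceT => z; exact: continuous_sin.
by rewrite distrC e normrM distrC ler_piMl// ler_norml cos_geN1 cos_le1.
Qed.

(** By the mean value theorem the left side is [s * (sin x - sin c)] with [c] at distance at most
    [|s|] from [x], and [sin] is 1-Lipschitz. The sharp constant 1/2 is not sought. *)
Lemma norm_cos_taylor1_le (x s : R) : `|cos (x + s) - cos x + s * sin x| <= s ^+ 2.
Proof.
have [c [cs e]] : exists c, `|c - x| <= `|s| /\ cos (x + s) - cos x = - sin c * s.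
  have cc (a b : R) : {within `[a, b], continuous (@cos R)}.
    by apply/continuous_subspaceT => z; exact: continuous_cos.
  have [s0|s0] := lerP 0 s.
    have xs : x <= x + s by rewrite lerDl.
    have [c + e] := MVT_segment xs (fun z _ => is_derive_cos z) (cc _ _).
    rewrite in_itv/= => /andP[c1 c2]; exists c; split; last by rewrite e addrC addKr.
    by rewrite !ger0_norm; lra.
  have xs : x + s <= x by lra.
  have [c + e] := MVT_segment xs (fun z _ => is_derive_cos z) (cc _ _).
  rewrite in_itv/= => /andP[c1 c2]; exists c; split.
    by rewrite !ler0_norm; lra.
  by rewrite -opprB e; ring.
rewrite e (_ : _ + _ = s * (sin x - sin c)); last by ring.
rewrite normrM -real_normK ?num_real// expr2 ler_wpM2l//.
by apply: (le_trans (norm_sinB_le _ _)); rewrite distrC.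
Qed.

(* [trig_series b lam phi m] is the [m]-th derivative of
   [t |-> \sum_k b k * cos (lam k * t + phi)]; the phase [phi = - pi / 2]
   turns the cosines into sines. *)
Definition trig_series (b lam : nat -> R) (phi : R) (m : nat) (t : R) : R :=
  limn (series (fun k =>
    b k * lam k ^+ m * cos (lam k * t + phi + m%:R * (pi / 2)))).

Section RapidlyDecreasing.
Variables (b lam : nat -> R).
Hypotheses (b_ge0 : forall k, 0 <= b k) (lam_ge0 : forall k, 0 <= lam k).
Hypothesis decr : forall m, exists A, forall k, b k * lam k ^+ m <= A / 2 ^+ k.

Let term_ge0 m k : 0 <= b k * lam k ^+ m.
Proof. by rewrite mulr_ge0 ?exprn_ge0. Qed.

Let term_cos_le A m (th : nat -> R) :
  (forall k, b k * lam k ^+ m <= A / 2 ^+ k) ->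
  forall k, `|b k * lam k ^+ m * cos (th k)| <= A / 2 ^+ k.
Proof.
move=> h k; apply: le_trans (h k); rewrite normrM (ger0_norm (term_ge0 _ _)).
by rewrite ler_piMr// ler_norml cos_geN1 cos_le1.
Qed.

Let term_cos_cvg m (th : nat -> R) :
  cvgn (series (fun k => b k * lam k ^+ m * cos (th k))).
Proof.
have [A hA] := decr m; apply: normed_cvg.
exact: (is_cvg_geometric_bounded (term_cos_le th hA)).
Qed.

Let term_cvg m : cvgn (series (fun k => b k * lam k ^+ m)).
Proof.
rewrite (_ : (fun k => _) = fun k => b k * lam k ^+ m * cos 0).
  exact: term_cos_cvg.
by apply/funext => k; rewrite cos0 mulr1.
Qed.

Lemma norm_trig_series_le phi m t A :
  (forall k, b k * lam k ^+ m <= A / 2 ^+ k) ->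
  `|trig_series b lam phi m t| <= 2 * A.
Proof. by move=> h; exact/norm_lim_geometric_bounded/term_cos_le. Qed.

(** The remainder of the [k]-th term is at most [b k * lam k ^+ m.+2 * s ^+ 2], so the decay at
    order [m.+2] bounds the sum of all remainders by a multiple of [s ^+ 2]. *)
Lemma is_derive_trig_series (phi : R) (m : nat) (t : R) :
  is_derive t 1 (trig_series b lam phi m) (trig_series b lam phi m.+1 t).
Proof.
have [A hA] := decr m.+2.
apply: (@is_derive_quadratic _ _ _ (2 * A)) => s.
pose th k := lam k * t + phi + m%:R * (pi / 2).
pose th' k := lam k * (s + t) + phi + m%:R * (pi / 2).
pose th'' k := lam k * t + phi + m.+1%:R * (pi / 2).
pose u k := b k * lam k ^+ m * cos (th k).
pose u' k := b k * lam k ^+ m * cos (th' k).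
pose u'' k := b k * lam k ^+ m.+1 * cos (th'' k).
rewrite /trig_series -/u -/u' -/u''.
have cu : cvgn (series u) by exact: term_cos_cvg.
have cu' : cvgn (series u') by exact: term_cos_cvg.
have cu'' : cvgn (series u'') by exact: term_cos_cvg.
rewrite -lim_seriesB// -[s * _]/(s *: _) -lim_seriesZ// -lim_seriesB//; last 2 first.
- exact: is_cvg_seriesB.
- exact: is_cvg_seriesZ.
rewrite -mulrA; apply: norm_lim_geometric_bounded => k.
rewrite !fctE.
have -> : u' k - u k - s *: u'' k =
    b k * lam k ^+ m * (cos (th k + lam k * s) - cos (th k) + lam k * s * sin (th k)).
  change (u' k - u k - s * u'' k = b k * lam k ^+ m *
    (cos (th k + lam k * s) - cos (th k) + lam k * s * sin (th k))).
  rewrite /u /u' /u''.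
  (* One more derivative shifts the phase by [pi / 2], which turns the cosine into minus the
     sine. *)
  have -> : th'' k = th k + pi / 2 by rewrite /th'' /th -natr1; ring.
  have -> : th' k = th k + lam k * s by rewrite /th' /th; ring.
  by rewrite cosDpihalf exprS; ring.
rewrite normrM (ger0_norm (term_ge0 _ _)).
apply: (@le_trans _ _ (b k * lam k ^+ m * (lam k * s) ^+ 2)).
  by rewrite ler_wpM2l// norm_cos_taylor1_le.
have -> : b k * lam k ^+ m * (lam k * s) ^+ 2 = b k * lam k ^+ m.+2 * s ^+ 2.
  by rewrite !exprS; ring.
by rewrite [leRHS]mulrAC ler_wpM2r// sqr_ge0.
Qed.

Lemma trig_series0 phi m :
  trig_series b lam phi m 0 =
  limn (series (fun k => b k * lam k ^+ m)) * cos (phi + m%:R * (pi / 2)).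
Proof.
have cb := @term_cvg m.
rewrite mulrC -[_ * _]/(_ *: _) -lim_seriesZ// /trig_series.
congr (limn (series _)); apply/funext => k.
by rewrite fctE mulr0 add0r [RHS]mulrC.
Qed.

Lemma term_le_lim_series m k :
  b k * lam k ^+ m <= limn (series (fun k => b k * lam k ^+ m)).
Proof.
apply: (@le_trans _ _ (series (fun k => b k * lam k ^+ m) k.+1)).
  by rewrite /series/= big_nat_recr//= lerDr sumr_ge0.
apply: nondecreasing_cvgn_le; last exact: term_cvg.
by apply/nondecreasing_seqP => n; rewrite /series/= big_nat_recr//= lerDl.
Qed.

End RapidlyDecreasing.
End TrigonometricSeries.

(** * Exponential sums in one coordinate direction as smooth functions of [d] variables *)

Section ExponentialSeries.
Context {R : realType} {d : nat}.

Section Construction.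
Variables (i0 : 'I_d) (a : 'rV[R]_d) (b lam : nat -> R).
Hypotheses (b_ge0 : forall k, 0 <= b k) (lam_ge0 : forall k, 0 <= lam k).
Hypothesis decr : forall m, exists A, forall k, b k * lam k ^+ m <= A / 2 ^+ k.

(** The factor [c] collects the values [(i == i0)%:R] produced by the partial derivatives, so that
    the family is closed under all of them. *)
Let coord (c phi : R) m (x : 'rV[R]_d) : R :=
  c * trig_series b lam phi m (x 0 i0 - a 0 i0).

Let is_derive_coord c phi m i x :
  is_derive x (delta_mx 0 i) (coord c phi m)
    (coord (c * (i == i0)%:R) phi m.+1 x).
Proof.
pose W := trig_series b lam phi m; pose t := x 0 i0 - a 0 i0.
have [dW eW] := is_derive_trig_series b_ge0 lam_ge0 decr phi m t.
(* Along [delta_mx 0 i] the coordinate [i0] moves with speed [(i == i0)%:R], which reduces the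
   quotient to one variable. *)
have E : (fun h => h^-1 *: ((coord c phi m \o shift x) (h *: delta_mx 0 i) -
    coord c phi m x)) =
    (c * (i == i0)%:R) \*o (fun h : R => h^-1 *: ((W \o shift t) (h *: (1 : R)) - W t)).
  apply/funext => h /=; rewrite /coord -/W -/t !mxE eqxx /=.
  have [_|_] := eqVneq i i0; last first.
    by rewrite /= mulr0 mulr0 add0r subrr scaler0 mul0r.
  rewrite !mulr1 -addrA -/t [h *: 1]mulr1 -mulrBr.
  exact: mulrCA.
have cW : (c * (i == i0)%:R) \*o
    (fun h : R => h^-1 *: ((W \o shift t) (h *: (1 : R)) - W t)) @ 0^' -->
    coord (c * (i == i0)%:R) phi m.+1 x.
  by rewrite /coord -/t -eW; apply: cvgMr.
by apply: DeriveDef; [apply/cvg_ex; eexists; rewrite E; exact: cW|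
  rewrite /derive E; exact/cvg_lim].
Qed.

Let continuous_coord c phi m : continuous (coord c phi m).
Proof.
pose W t := c * trig_series b lam phi m t.
have cW : continuous W.
  move=> t; apply: cvgMr.
  apply: differentiable_continuous; apply/derivable1_diffP.
  by have [] := is_derive_trig_series b_ge0 lam_ge0 decr phi m t.
have -> : coord c phi m = W \o (fun y : 'rV[R]_d => y 0 i0 - a 0 i0) by [].
move=> x; apply: continuous_comp; last exact: cW.
apply: continuousB; last exact: cst_continuous.
exact: (@coord_continuous R 1 d 0 i0 x).
Qed.

Let dexp (c : R) m (x : 'rV[R]_d) : R[i] :=
  Complex (coord c 0 m x) (coord c (- (pi / 2)) m x).

Let partial_dexp i c m :
  partial_derivative i (dexp c m) = dexp (c * (i == i0)%:R) m.+1.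
Proof.
apply/funext => x; rewrite /partial_derivative /dexp.
congr Complex; first by case: (is_derive_coord c 0 m i x).
by case: (is_derive_coord c (- (pi / 2)) m i x).
Qed.

Let iter_partial_dexp i c m n :
  iter n (partial_derivative i) (dexp c m) =
  dexp (c * (i == i0)%:R ^+ n) (n + m).
Proof.
elim: n => [|n IH] /=; first by rewrite expr0 mulr1.
by rewrite IH partial_dexp exprSr mulrA addSn.
Qed.

Let derivative_mi_dexp al :
  derivative_mi al (dexp 1 0) =
  dexp (\prod_(i < d) (i == i0)%:R ^+ al i) (order_mi al).
Proof.
rewrite /derivative_mi /order_mi -!(big_enum _ _ xpredT)/=.
elim: (enum _) => [|i s IH] /=; first by rewrite !big_nil.
by rewrite IH iter_partial_dexp !big_cons mulrC.
Qed.

Let smooth_dexp U c m : smooth_on U (dexp c m).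
Proof.
move=> s x _ g.
have [c' [m' ->]] : exists c' m', g = dexp c' m'.
  rewrite {}/g; elim: s => [|i s [c' [m' IH]]]; first by exists c, m.
  by rewrite /= IH partial_dexp; do 2 eexists.
split; [exact: continuous_coord..|move=> i].
by split; [case: (is_derive_coord c' 0 m' i x)|
  case: (is_derive_coord c' (- (pi / 2)) m' i x)].
Qed.

(* All the terms of the series [\sum_k b k * expC (lam k * (x i0 - a i0))] and
   of its derivatives have the same argument at the point [a], so that no
   cancellation occurs there. *)
Lemma exponential_series : exists f : 'rV[R]_d -> R[i],
  [/\ forall U, smooth_on U f,
      forall A m, (forall k, b k * lam k ^+ m <= A / 2 ^+ k) ->
        forall al x, order_mi al = m ->
        ComplexField.Normc.normc (derivative_mi al f x) <= 4 * A &
      forall m, exists2 al, order_mi al = m & forall k,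
        b k * lam k ^+ m <= ComplexField.Normc.normc (derivative_mi al f a)].
Proof.
exists (dexp 1 0); split=> [U|A m hA al x alm|m]; first exact: smooth_dexp.
  rewrite derivative_mi_dexp alm; set c := \prod_(i < d) _.
  have c01 : 0 <= c <= 1.
    apply/andP; split; first by apply: prodr_ge0 => i _; rewrite exprn_ge0.
    by apply: prodr_ile1 => i _; rewrite exprn_ge0//= exprn_ile1//; case: eqP.
  have A0 : 0 <= A.
    have := norm_trig_series_le b_ge0 lam_ge0 0 0 hA.
    by move/(le_trans (normr_ge0 _)); rewrite pmulr_rge0.
  have le phi : `|coord c phi m x| <= 2 * A.
    rewrite normrM ger0_norm; last by case/andP: c01.
    apply: le_trans (norm_trig_series_le b_ge0 lam_ge0 phi (x 0 i0 - a 0 i0) hA).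
    by rewrite ler_piMl//; case/andP: c01.
  (* Both parts are at most [2 * A] in absolute value, so the modulus is at most [sqrt 8 * A],
     rounded up to [4 * A]. *)
  rewrite /= -[leRHS]ger0_norm ?mulr_ge0// -sqrtr_sqr ler_sqrt ?sqr_ge0//.
  have sq phi : coord c phi m x ^+ 2 <= (2 * A) ^+ 2.
    by rewrite -real_normK ?num_real// lerXn2r ?nnegrE ?mulr_ge0.
  apply: (le_trans (lerD (sq _) (sq _))).
  by have := sqr_ge0 A; nra.
pose al : multi_index := [ffun i => if i == i0 then m else 0%N].
have alm : order_mi al = m.
  rewrite /order_mi (bigD1 i0)//= ffunE eqxx big1 ?addn0// => i ne.
  by rewrite ffunE (negbTE ne).
exists al => // k; rewrite derivative_mi_dexp alm.
(* The product is 1: the factor at [i0] is a power of 1, and every other one is [0 ^+ 0 = 1]. *)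
rewrite big1 => [|i _]; last first.
  by rewrite ffunE; case: eqP => _; rewrite ?expr1n ?expr0.
apply: (le_trans (term_le_lim_series b_ge0 lam_ge0 decr m k)).
rewrite /= /coord subrr !trig_series0// !mul1r add0r.
rewrite [- _ + _]addrC cosBpihalf !exprMn -mulrDr cos2Dsin2 mulr1 sqrtr_sqr.
exact: ler_norm.
Qed.

End Construction.
End ExponentialSeries.

(** * Log-convex weights and linear lower bounds for [Phi] *)

Section WeightSequenceLemmas.
Context {R : realType}.
Implicit Types (N M Phi : nat -> R).

Lemma powR_inv (a x : R) : 0 <= a -> a^-1 `^ x = (a `^ x)^-1.
Proof. by move=> a0; rewrite -powR_inv1// -powRrM mulN1r powRN. Qed.

Lemma log_convex_ratio N : positive_seq N -> log_convex N ->
  {homo (fun k => N k.+1 / N k) : i j / (i <= j)%N >-> i <= j}.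
Proof.
move=> N0 Nc; apply/nondecreasing_seqP => n.
rewrite ler_pdivrMr// mulrAC ler_pdivlMr// [leRHS]mulrC -expr2.
exact: (Nc n.+1).
Qed.

(* The tangent line at [k] to the convex function [log \o N] lies below it. *)
Lemma log_convex_tangent N k j : positive_seq N -> log_convex N ->
  N k / (N k.+1 / N k) ^+ k * (N k.+1 / N k) ^+ j <= N j.
Proof.
move=> N0 Nc; set nu := N k.+1 / N k.
have nu0 : 0 < nu by rewrite divr_gt0.
have nuX n : 0 < nu ^+ n by rewrite exprn_gt0.
(* The ratios [N i.+1 / N i] are at least [nu] past [k] and at most [nu] before [k]; multiplying
   them gives the bound on either side. *)
have up m : N k * nu ^+ m <= N (k + m)%N.
  elim: m => [|m IH]; first by rewrite addn0 expr0 mulr1.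
  rewrite addnS exprSr mulrA; apply: (@le_trans _ _ (N (k + m)%N * nu)).
    by rewrite ler_wpM2r// ltW.
  rewrite mulrC -ler_pdivlMr//; apply: log_convex_ratio => //.
  exact: leq_addr.
have down m : (m <= k)%N -> N k <= N (k - m)%N * nu ^+ m.
  elim: m => [|m IH] mk; first by rewrite subn0 expr0 mulr1.
  apply: (le_trans (IH (ltnW mk))); rewrite exprS mulrA.
  apply: ler_wpM2r; first exact: ltW.
  rewrite mulrC -ler_pdivrMr// -[in N (k - m)%N](@subnSK m k)//.
  by apply: log_convex_ratio => //; rewrite leq_subr.
rewrite mulrAC ler_pdivrMr//.
have [kj|jk] := leqP k j.
  rewrite -(subnKC kj) exprD [nu ^+ k * _]mulrC mulrA.
  by apply: ler_wpM2r => //; exact: ltW.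
have -> : nu ^+ k = nu ^+ (k - j) * nu ^+ j by rewrite -exprD subnK// ltnW.
rewrite mulrA; apply: ler_wpM2r; first exact: ltW.
by have := down (k - j)%N (leq_subr _ _); rewrite subKn 1?ltnW.
Qed.

Lemma near_infty_natP (P : nat -> Prop) :
  (\forall j \near \oo, P j) -> exists J, forall j, (J <= j)%N -> P j.
Proof. by case=> J _ h; exists J => j; exact: h. Qed.

(** The constant absorbs the finitely many ratios [|u i| / v i] with [i < J]. *)
Lemma eventually_le_bound (u v : nat -> R) (J : nat) : (forall j, 0 < v j) ->
  (forall j, (J <= j)%N -> u j <= v j) ->
  exists2 C, 1 <= C & forall j, u j <= C * v j.
Proof.
move=> v0 uv; exists (1 + \sum_(i < J) `|u i| / v i).
  by rewrite lerDl sumr_ge0// => i _; rewrite divr_ge0// ltW.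
move=> j; rewrite -ler_pdivrMr//; have [Jj|jJ] := leqP J j.
  apply: (@le_trans _ _ 1); first by rewrite ler_pdivrMr// mul1r uv.
  by rewrite lerDl sumr_ge0// => i _; rewrite divr_ge0// ltW.
rewrite (bigD1 (Ordinal jJ))//= addrCA.
apply: (@le_trans _ _ (`|u j| / v j)).
  by apply: ler_wpM2r; [rewrite invr_ge0 ltW|exact: ler_norm].
by rewrite lerDl addr_ge0// sumr_ge0// => i _; rewrite divr_ge0// ltW.
Qed.

(** Past some index the [j]-th root of [N j] is at least [lam]; [j]-th powers compare the sequences
    there, and the remaining terms go into [C]. *)
Lemma root_tends_to_infty_bound N (lam : R) : positive_seq N ->
  root_tends_to_infty N -> 0 <= lam ->
  exists2 C, 1 <= C & forall j, lam ^+ j <= C * N j.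
Proof.
move=> N0 Noo lam0.
have /near_infty_natP[J hJ] : \forall j \near \oo, lam <= N j `^ j%:R^-1.
  by move/cvgryPge : Noo; apply.
apply: (@eventually_le_bound _ _ J.+1) => // j Jj.
have j0 : j%:R != 0 :> R by rewrite pnatr_eq0 -lt0n (leq_ltn_trans _ Jj).
rewrite -[leRHS](powRr1 (ltW (N0 j))) -(mulVf j0) powRrM powR_mulrn ?powR_ge0//.
by apply: lerXn2r; rewrite ?nnegrE ?powR_ge0// hJ// ltnW.
Qed.

Lemma log_convex_up_to_finite_bound N : positive_seq N ->
  log_convex_up_to_finite N ->
  exists N' C J, [/\ positive_seq N', log_convex N', 1 <= C,
    forall j, N' j <= C * N j & forall j, (J <= j)%N -> N' j = N j].
Proof.
move=> N0 [N' [/finite_seqP[s sE] N'0 N'c _]].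
pose J := (\max_(i <- s) i).+1.
have NE j : (J <= j)%N -> N' j = N j.
  move=> Jj; apply: contrapT => nE.
  have : [set` s] j by rewrite -sE.
  move=> /= js; have := @leq_bigmax_seq _ _ xpredT id _ js isT.
  by rewrite leqNgt Jj.
have [C C1 hC] : exists2 C, 1 <= C & forall j, N' j <= C * N j.
  by apply: (@eventually_le_bound _ _ J) => // j /NE ->.
by exists N', C, J.
Qed.

(** Positivity of the lower limit in a form free of extended reals and of division by [j]; its
    negation yields arbitrarily late indices where [Phi] is small. *)
Definition eventually_linear_below Phi :=
  exists a J, 0 < a /\ forall j, (J <= j)%N -> a * j%:R <= Phi j.

Lemma eventually_linear_below_liminf Phi :
  eventually_linear_below Phi -> (0 < liminf_ratio Phi)%E.
Proof.
move=> [a [J [a0 h]]]; rewrite /liminf_ratio limn_einf_lim.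
apply: (@lt_le_trans _ _ a%:E); first by rewrite lte_fin.
apply: lime_ge; first exact: is_cvg_einfs.
exists J.+1 => // n /= Jn; apply: le_ereal_inf_tmp => _ [k /= nk <-].
have k0 : (0 < k)%N by exact: leq_trans (leq_trans Jn nk).
rewrite lee_fin ler_pdivlMr ?ltr0n// h//.
exact: leq_trans (ltnW Jn) nk.
Qed.

(** Logarithms give [j * ln 2 <= ln D + Phi j * ln L]. Raising [D] to at least 1 and [L] to at least
    2 keeps the logarithms nonnegative and the divisor [ln L'] positive. *)
Lemma eventually_linear_below_pow Phi (D L : R) :
  (forall j, 0 <= Phi j) -> 0 < L ->
  (forall j, 2 ^+ j <= D * L `^ Phi j) -> eventually_linear_below Phi.
Proof.
move=> Phi0 L0 h.
pose D' := Num.max D 1; pose L' := Num.max L 2.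
have D'1 : 1 <= D' by rewrite le_max lexx orbT.
have L'2 : 2 <= L' by rewrite le_max lexx orbT.
have ln2 : 0 < ln (2 : R) by rewrite ln_gt0// ltr1n.
have lnL : 0 < ln L' by rewrite ln_gt0//; lra.
have lnD : 0 <= ln D' by rewrite ln_ge0.
have key j : j%:R * ln 2 <= ln D' + Phi j * ln L'.
  have L'p : 0 < L' `^ Phi j by rewrite powR_gt0//; lra.
  rewrite -ln_powR -ln_powR -lnM ?posrE ?powR_gt0//; [|lra..].
  rewrite ler_ln ?posrE ?mulr_gt0 ?powR_gt0 ?powR_mulrn//; [|lra..].
  apply: (le_trans (h j)); apply: (@le_trans _ _ (D' * L `^ Phi j)).
    by apply: ler_wpM2r; rewrite ?powR_ge0// le_max lexx.
  rewrite ler_wpM2l//; first by lra.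
  by apply: ge0_ler_powR; rewrite ?nnegrE ?le_max ?lexx//; lra.
(* From this index on, [ln D'] is at most half of [j * ln 2], and the other half is left for
   [Phi j]. *)
exists (ln 2 / (2 * ln L')), (Num.truncn (2 * ln D' / ln 2)).+1; split.
  by rewrite divr_gt0// mulr_gt0.
move=> j; rewrite truncn_lt_nat; last by rewrite divr_ge0 ?mulr_ge0// ltW.
rewrite ltr_pdivrMr// => hj.
rewrite mulrAC ler_pdivrMr ?mulr_gt0//; have := key j; lra.
Qed.

End WeightSequenceLemmas.

(** * Weighted norms, and continuity of the inclusion from linear growth *)

Section WeightedNorm.
Context {R : realType} {d : nat}.
Implicit Types (W M Phi : nat -> R) (K U : set 'rV[R]_d) (f : 'rV[R]_d -> R[i]).

Lemma weighted_norm_le W K f (D : R) : (forall j, 0 < W j) ->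
  (forall al x, K x ->
    ComplexField.Normc.normc (derivative_mi al f x) <= D * W (order_mi al)) ->
  (weighted_norm W K f <= D%:E)%E.
Proof.
move=> W0 h; apply: ge_ereal_sup => _ [al [x [Kx ->]]].
by rewrite lee_fin ler_pdivrMr// h.
Qed.

Lemma le_weighted_norm W K f (D : R) : (forall j, 0 < W j) ->
  (weighted_norm W K f <= D%:E)%E -> forall al x, K x ->
  ComplexField.Normc.normc (derivative_mi al f x) <= D * W (order_mi al).
Proof.
move=> W0 h al x Kx; rewrite -ler_pdivrMr// -lee_fin.
by apply: le_trans h; apply: ereal_sup_ubound; exists al, x.
Qed.

Lemma weighted_norm_lty W K f : (weighted_norm W K f < +oo)%E ->
  exists D : R, (weighted_norm W K f <= D%:E)%E.
Proof.
case: (weighted_norm W K f) => [D _|//|_]; first by exists D.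
by exists 0; rewrite leNye.
Qed.

Lemma compact_in_set1 U (a : 'rV[R]_d) : U a -> compact_in U [set a].
Proof. by move=> Ua; split; [exact: compact_set1|move=> _ ->]. Qed.

Lemma powR_mul_gt0 M Phi (c : R) j : positive_seq M -> 0 < c ->
  0 < c `^ Phi j * M j.
Proof. by move=> M0 c0; rewrite mulr_gt0// powR_gt0. Qed.

(** For [m <= 1], the inequality [j <= Phi j / a] shows that the power of [m] with exponent
    [Phi j / a] is eventually at most [m ^+ j]. Hence a base raised to [Phi j] can absorb the
    geometric factor [h ^+ j]. *)
Lemma eventually_linear_below_dom M Phi (x h : R) : positive_seq M ->
  (forall j, 0 <= Phi j) -> eventually_linear_below Phi -> 0 < x -> 0 < h ->
  exists h' C, [/\ 0 < h', 1 <= C &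
    forall j, h' `^ Phi j * M j <= C * (h ^+ j * Mc M Phi x j)].
Proof.
move=> M0 Phi0 [a [J [a0 lin]]] x0 h0.
pose m := Num.min h 1.
have m0 : 0 < m by rewrite lt_min h0 ltr01.
have m1 : m <= 1 by rewrite ge_min lexx orbT.
have mh : m <= h by rewrite ge_min lexx.
have [C C1 hC] : exists2 C, 1 <= C & forall j, m `^ (Phi j / a) <= C * h ^+ j.
  apply: (@eventually_le_bound _ _ _ J) => j; first by rewrite exprn_gt0.
  move=> Jj; apply: (@le_trans _ _ (m ^+ j)); last first.
    by rewrite lerXn2r// nnegrE ltW.
  rewrite -(powR_mulrn _ (ltW m0)); apply: ger_powR; first by rewrite m0 m1.
  by rewrite ler_pdivlMr// mulrC lin.
exists (m `^ a^-1 * x), C; split => //; first by rewrite mulr_gt0// powR_gt0.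
move=> j; rewrite (powRM _ (powR_ge0 _ _) (ltW x0)) -powRrM [a^-1 * _]mulrC.
rewrite /Mc -[leLHS]mulrA [leRHS]mulrA.
by apply: ler_wpM2r => //; rewrite mulr_ge0 ?powR_ge0// ltW.
Qed.

Lemma eventually_linear_below_continuous M Phi U : positive_seq M ->
  (forall j, 0 <= Phi j) -> eventually_linear_below Phi ->
  beurling_MPhi M Phi U `<=` beurling_family (Mc M Phi) U ->
  continuous_inclusion
    (beurling_MPhi M Phi U) (beurling_family (Mc M Phi) U)
    (beurling_MPhi_seminorms M Phi U)
    (beurling_family_seminorms (Mc M Phi) U).
Proof.
move=> M0 Phi0 lin incl; split=> // f _ q [K [x [h [Kc x0 h0 ->]]]] e e0.
have [h' [C [h'0 C1 hC]]] := eventually_linear_below_dom M0 Phi0 lin x0 h0.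
have C0 : 0 < C by lra.
(* The factor 2 restores the strict inequality, since pointwise bounds control the supremum only
   non-strictly. *)
pose r := e / (2 * C).
have r0 : 0 < r by rewrite divr_gt0// mulr_gt0.
exists [set norm_MPhi M Phi K h'], r; split => //.
  by move=> _ ->; exists K, h'.
move=> g _ /(_ _ erefl) gf.
apply: (@le_lt_trans _ _ (e / 2)%:E); last by rewrite lte_fin; lra.
apply: weighted_norm_le => [j|al y Ky].
  by rewrite mulr_gt0 ?exprn_gt0//; exact: powR_mul_gt0.
have W0 j : 0 < h' `^ Phi j * M j by exact: powR_mul_gt0.
apply: (le_trans (le_weighted_norm W0 (ltW gf) al Ky)).
apply: (@le_trans _ _ (r * (C * (h ^+ order_mi al * Mc M Phi x (order_mi al))))).
  by apply: ler_wpM2l; [exact: ltW|exact: hC].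
have -> : e / 2 = r * C by rewrite /r; field; rewrite gt_eqF.
by rewrite -[r * C * _]mulrA.
Qed.

End WeightedNorm.

(** * Linear growth of [Phi] from the Roumieu inclusion *)

Section Roumieu.
Context {R : realType} {d : nat}.

Lemma roumieu_inclusion_linear (i0 : 'I_d) (U : set 'rV[R]_d)
    (M Phi : nat -> R) (c : R) :
  U !=set0 -> positive_seq M -> (forall j, 0 <= Phi j) -> 0 < c ->
  log_convex (Mc M Phi c) ->
  roumieu_family (Mc M Phi) U `<=` roumieu_MPhi M Phi U ->
  eventually_linear_below Phi.
Proof.
move=> [a Ua] M0 Phi0 c0 Nc incl; pose N := Mc M Phi c.
have N0 : positive_seq N by move=> j; exact: powR_mul_gt0.
pose nu k := N k.+1 / N k.
have nu0 k : 0 < nu k by rewrite divr_gt0.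
pose b k := N k / nu k ^+ k / 2 ^+ k; pose lam k := 4 * nu k.
have b0 k : 0 <= b k.
  by rewrite !divr_ge0 ?exprn_ge0// ltW.
have lam0 k : 0 <= lam k by rewrite mulr_ge0// ltW.
have lamX m k : lam k ^+ m = 4 ^+ m * nu k ^+ m by exact: exprMn.
have bl m k : b k * lam k ^+ m <= 4 ^+ m * N m / 2 ^+ k.
  rewrite /b lamX.
  have -> : N k / nu k ^+ k / 2 ^+ k * (4 ^+ m * nu k ^+ m) =
      4 ^+ m * (N k / nu k ^+ k * nu k ^+ m) / 2 ^+ k by ring.
  rewrite ler_wpM2r ?invr_ge0 ?exprn_ge0// ler_wpM2l ?exprn_ge0//.
  exact: log_convex_tangent.
have dec m : exists A, forall k, b k * lam k ^+ m <= A / 2 ^+ k.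
  by exists (4 ^+ m * N m) => k; exact: bl.
have [f [fs fle fge]] := exponential_series i0 a b0 lam0 dec.
have /incl[_ /(_ _ (compact_in_set1 Ua))[h [h0 fh]]] :
    roumieu_family (Mc M Phi) U f.
  split=> // K _; exists c, 4; split => //.
  apply: (@le_lt_trans _ _ 4%:E); last exact: ltry.
  apply: weighted_norm_le => [j|al x _]; first by rewrite mulr_gt0 ?exprn_gt0.
  exact: (fle _ _ (bl _) al x erefl).
have [D hD] := weighted_norm_lty fh.
apply: (@eventually_linear_below_pow _ _ D (h / c)) => // [|j].
  by rewrite divr_gt0.
(* Only the term [k = j] is kept: the tangent line touches [N] there, and [4 ^+ j / 2 ^+ j] leaves
   [2 ^+ j * N j]. *)
have [al alj /(_ j) le1] := fge j.
have W0 i : 0 < h `^ Phi i * M i by exact: powR_mul_gt0.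
have := le_trans le1 (le_weighted_norm W0 hD al (erefl a)).
rewrite alj /b lamX (_ : (4 : R) ^+ j = 2 ^+ j * 2 ^+ j); last first.
  by rewrite -exprMn -natrM.
have -> : N j / nu j ^+ j / 2 ^+ j * (2 ^+ j * 2 ^+ j * nu j ^+ j) =
    2 ^+ j * N j.
  by field; rewrite !expf_neq0// gt_eqF.
rewrite /N /Mc !mulrA ler_pM2r// => le2.
rewrite powRM ?invr_ge0 ?(ltW h0) ?(ltW c0)//.
by rewrite (powR_inv _ (ltW c0)) mulrA ler_pdivlMr ?powR_gt0.
Qed.

End Roumieu.

(** * Linear growth of [Phi] from the Beurling inclusion *)

Section Beurling.
Context {R : realType} {d : nat}.

(* The frequency is the slope of the log-convex regularization at an index [j]
   with [Phi j] so small that the factor [k.+1%:R^-1 `^ Phi j] costs at most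
   [2 `^ (j%:R / 2)]. *)
Lemma beurling_frequency (M Phi : nat -> R) (k : nat) :
  positive_seq M -> (forall j, 0 <= Phi j) ->
  log_convex_up_to_finite (Mc M Phi k.+1%:R^-1) ->
  ~ eventually_linear_below Phi ->
  exists p : R * R, [/\ 0 <= p.1, 0 <= p.2,
    forall i, p.1 * p.2 ^+ i <= Mc M Phi k.+1%:R^-1 i / 2 ^+ k &
    exists j, k%:R * M j <= 2 ^+ j * (p.1 * p.2 ^+ j)].
Proof.
move=> M0 Phi0 lcN nlin; set c : R := k.+1%:R^-1 in lcN *.
have c0 : 0 < c by rewrite invr_gt0 ltr0n.
have N0 : positive_seq (Mc M Phi c) by move=> j; exact: powR_mul_gt0.
have [N [C [J [N'0 Nc C1 NC NE]]]] := log_convex_up_to_finite_bound N0 lcN.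
have C0 : 0 < C by lra.
(* [2 ^+ n] dominates the constants, so for [2 * n <= j] one square root of [2 ^+ j] pays for them;
   the other pays for the power of [k.+1]. *)
pose n := (Num.truncn (k%:R * 2 ^+ k * C)).+1.
have nP : k%:R * 2 ^+ k * C <= 2 ^+ n.
  apply: (@le_trans _ _ n%:R); last by rewrite -natrX ler_nat ltnW// ltn_expl.
  by rewrite ltW// -truncn_lt_nat// !mulr_ge0 ?exprn_ge0// ltW.
have [j [jJ jn Phij]] : exists j, [/\ (J <= j)%N, (2 * n <= j)%N &
    Phi j < (2 * k.+1%:R)^-1 * j%:R].
  apply: contrapT => H; apply: nlin.
  exists (2 * k.+1%:R)^-1, (maxn J (2 * n)); split.
    by rewrite invr_gt0 mulr_gt0// ltr0n.
  move=> j; rewrite geq_max => /andP[jJ jn]; rewrite leNgt; apply/negP => lt.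
  by apply: H; exists j.
pose nu := N j.+1 / N j.
have nu0 : 0 < nu by rewrite divr_gt0.
have k2 : 0 < (2 : R) ^+ k by rewrite exprn_gt0.
(* Division by [C] passes from the regularization [N] back to the weight itself, and [2 ^+ k]
   provides summability over [k]. *)
exists (N j / nu ^+ j / C / 2 ^+ k, nu); split => /=.
- by rewrite !divr_ge0 ?exprn_ge0// ltW.
- exact: ltW.
- move=> i; rewrite [leLHS]mulrAC; apply: ler_wpM2r; first by rewrite invr_ge0 ltW.
  rewrite [leLHS]mulrAC ler_pdivrMr// mulrC [leRHS]mulrC.
  by apply: le_trans (NC i) => /=; rewrite mulrC; exact: log_convex_tangent.
exists j.
have -> : N j / nu ^+ j / C / 2 ^+ k * nu ^+ j = N j / (C * 2 ^+ k).
  by field; rewrite !expf_neq0 ?gt_eqF.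
rewrite mulrA ler_pdivlMr ?mulr_gt0// NE// /Mc mulrA [leLHS]mulrAC.
apply: ler_wpM2r; first exact: ltW.
rewrite /c powR_inv// ler_pdivlMr ?powR_gt0//.
(* This combines [k.+1 <= 2 ^+ k.+1] with [k.+1 * Phi j < j / 2]. *)
have kle : k.+1%:R `^ Phi j <= 2 `^ (j%:R / 2) :> R.
  apply: (@le_trans _ _ ((2 ^+ k.+1) `^ Phi j)).
    apply: ge0_ler_powR; rewrite ?nnegrE ?exprn_ge0//.
    by rewrite -natrX ler_nat ltnW// ltn_expl.
  rewrite -powR_mulrn// -powRrM; apply: ler_powR; first by rewrite ler1n.
  move: Phij; rewrite -ltr_pdivrMl ?invr_gt0 ?mulr_gt0 ?ltr0n// invrK; lra.
have -> : (2 : R) ^+ j = 2 `^ (j%:R / 2) * 2 `^ (j%:R / 2).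
  by rewrite -powRD ?pnatr_eq0 ?implybT// -powR_mulrn//; congr (_ `^ _); lra.
apply: ler_pM; rewrite ?powR_ge0 ?mulr_ge0 ?exprn_ge0 ?(ltW C0)//.
rewrite [C * _]mulrC mulrA; apply: (le_trans nP).
rewrite -powR_mulrn//; apply: ler_powR; first by rewrite ler1n.
by rewrite ler_pdivlMr// -natrM ler_nat mulnC.
Qed.

Lemma beurling_inclusion_linear (i0 : 'I_d) (U : set 'rV[R]_d)
    (M Phi : nat -> R) :
  U !=set0 -> positive_seq M -> (forall j, 0 <= Phi j) ->
  (forall c : R, 0 < c -> root_tends_to_infty (Mc M Phi c) /\
    log_convex_up_to_finite (Mc M Phi c)) ->
  beurling_MPhi M Phi U `<=` beurling_family (Mc M Phi) U ->
  eventually_linear_below Phi.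
Proof.
move=> [a Ua] M0 Phi0 hN incl; apply: contrapT => nlin.
have c0 k : 0 < k.+1%:R^-1 :> R by rewrite invr_gt0 ltr0n.
have [p pP] := choice (fun k =>
  beurling_frequency M0 Phi0 (proj2 (hN _ (c0 k))) nlin).
pose b k := (p k).1; pose lam k := (p k).2.
have b0 k : 0 <= b k by case: (pP k).
have lam0 k : 0 <= lam k by case: (pP k).
(* For fixed [h], all [k] with [k.+1%:R^-1 <= h] are bounded uniformly by the choice of the pairs.
   Each of the finitely many others is bounded because the roots of the weight tend to infinity. *)
have bl h : 0 < h -> exists2 C, 1 <= C &
    forall m k, b k * lam k ^+ m <= C * (h `^ Phi m * M m) / 2 ^+ k.
  move=> h0; have [roots _] := hN h h0.
  have N0 : positive_seq (Mc M Phi h) by move=> j; exact: powR_mul_gt0.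
  pose v (m : nat) := h `^ Phi m * M m.
  have fin k : exists C, 1 <= C /\ forall m, b k * lam k ^+ m <= C * v m / 2 ^+ k.
    have [C C1 hC] := root_tends_to_infty_bound N0 roots (lam0 k).
    exists (1 + b k * C * 2 ^+ k); split.
      by rewrite lerDl !mulr_ge0 ?exprn_ge0//; lra.
    move=> m; rewrite ler_pdivlMr ?exprn_gt0// mulrDl mul1r.
    apply: (@le_trans _ _ (b k * C * 2 ^+ k * v m)); last first.
      by rewrite lerDr ltW//; exact: powR_mul_gt0.
    have -> : b k * C * 2 ^+ k * v m = b k * (C * v m) * 2 ^+ k by ring.
    apply: ler_wpM2r; first by rewrite exprn_ge0.
    by apply: ler_wpM2l => //; exact: hC.
  have [C hC] := choice fin.
  pose K := Num.truncn h^-1.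
  exists (1 + \sum_(k < K) C k).
    by rewrite lerDl sumr_ge0// => k _; case: (hC k) => C1 _; lra.
  move=> m k; have [Kk|kK] := leqP K k.
    have [_ _ /(_ m) h1 _] := pP k; apply: (le_trans h1).
    rewrite ler_wpM2r ?invr_ge0 ?exprn_ge0//.
    apply: (@le_trans _ _ (v m)); last first.
      rewrite ler_peMl// ?lerDl ?sumr_ge0// => [|l _].
        by rewrite ltW//; exact: powR_mul_gt0.
      by case: (hC l) => C1 _; lra.
    rewrite /v /Mc; apply: ler_wpM2r; first exact: ltW.
    apply: ge0_ler_powR; rewrite ?nnegrE// ?(ltW h0)//.
    rewrite -[leRHS]invrK lef_pV2 ?posrE ?invr_gt0 ?ltr0n// ltW//.
    by rewrite -truncn_lt_nat ?ltnS// invr_ge0 ltW.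
  have [C1 hk] := hC k; apply: (le_trans (hk m)).
  rewrite ler_wpM2r ?invr_ge0 ?exprn_ge0// ler_wpM2r//.
    by rewrite ltW//; exact: powR_mul_gt0.
  rewrite (bigD1 (Ordinal kK))//= addrCA lerDl addr_ge0// sumr_ge0// => l _.
  by case: (hC l) => ? _; lra.
have dec m : exists A, forall k, b k * lam k ^+ m <= A / 2 ^+ k.
  have [C _ hC] := bl 1 ltr01.
  by exists (C * (1 `^ Phi m * M m)) => k; exact: hC.
have [f [fs fle fge]] := exponential_series i0 a b0 lam0 dec.
(* The contradiction comes from the target seminorm at the single point [a] with [x = 1] and
   [h = 2^-1]. *)
have /incl[_ /(_ _ (compact_in_set1 Ua) 1 2^-1 ltr01)] : beurling_MPhi M Phi U f.
  split=> // K _ h h0; have [C C1 hC] := bl h h0.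
  apply: (@le_lt_trans _ _ (4 * C)%:E); last exact: ltry.
  apply: weighted_norm_le => [j|al x _]; first exact: powR_mul_gt0.
  by rewrite -mulrA; exact: (fle _ _ (hC _) al x erefl).
rewrite invr_gt0 ltr0n => /(_ isT)/weighted_norm_lty[D hD].
(* This index exceeds [D], whereas the seminorm bound at order [j] forces it to be at most [D]. *)
have [_ _ _ [j jP]] := pP (Num.truncn `|D|).+1.
have [al alj /(_ (Num.truncn `|D|).+1) le1] := fge j.
have W0 i : 0 < 2^-1 ^+ i * Mc M Phi 1 i.
  by rewrite mulr_gt0 ?exprn_gt0 ?invr_gt0//; exact: powR_mul_gt0.
have le2 : 2 ^+ j * (b (Num.truncn `|D|).+1 * lam (Num.truncn `|D|).+1 ^+ j)
    <= D * M j.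
  rewrite mulrC -ler_pdivlMr ?exprn_gt0//.
  apply: (le_trans (le_trans le1 (le_weighted_norm W0 hD al (erefl a)))).
  by rewrite alj /Mc powR1 mul1r exprVn mulrAC mulrA.
have := le_trans jP le2; rewrite ler_pM2r// leNgt => /negP; apply.
apply: (le_lt_trans (ler_norm D)).
by rewrite -truncn_lt_nat.
Qed.

End Beurling.

Theorem theorem4p9 (R : realType) (d : nat) (hd : (0 < d)%N)
    (U : set 'rV[R]_d) (U_open : open U) (U_neq0 : U !=set0)
    (M Phi : nat -> R) (M_gt0 : positive_seq M)
    (Phi_ge0 : forall j, 0 <= Phi j) :
  [/\ (exists c : R,
         [/\ 0 < c, log_convex (Mc M Phi c) & normalized (Mc M Phi c)]) ->
      roumieu_family (Mc M Phi) U `<=` roumieu_MPhi M Phi U ->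
      (0 < liminf_ratio Phi)%E,
      class_LC M ->
      roumieu_family (Mc M Phi) U `<=` roumieu_MPhi M Phi U ->
      (0 < liminf_ratio Phi)%E
    & (forall c : R, 0 < c ->
         root_tends_to_infty (Mc M Phi c) /\
         log_convex_up_to_finite (Mc M Phi c)) ->
      beurling_MPhi M Phi U `<=` beurling_family (Mc M Phi) U ->
      continuous_inclusion
        (beurling_MPhi M Phi U) (beurling_family (Mc M Phi) U)
        (beurling_MPhi_seminorms M Phi U)
        (beurling_family_seminorms (Mc M Phi) U) /\
      (0 < liminf_ratio Phi)%E].
Proof.
have i0 : 'I_d by exact: Ordinal hd.
split.
- move=> [c [c0 Nc _]] incl; apply: eventually_linear_below_liminf.
  exact: (roumieu_inclusion_linear i0 U_neq0 M_gt0 Phi_ge0 c0 Nc incl).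
- move=> [_ _ Mc1 _] incl; apply: eventually_linear_below_liminf.
  apply: (roumieu_inclusion_linear i0 U_neq0 M_gt0 Phi_ge0 ltr01 _ incl).
  suff -> : Mc M Phi 1 = M by [].
  by apply/funext => j; rewrite /Mc powR1 mul1r.
- move=> hN incl.
  have lin := beurling_inclusion_linear i0 U_neq0 M_gt0 Phi_ge0 hN incl.
  split; last exact: eventually_linear_below_liminf.
  exact: eventually_linear_below_continuous.
Qed.
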